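(* Fix integers $\lambda \geq 2$ and $\mu \geq 0$, and a polynomial $\alpha \in \mathbb{Z}[n,k]$ such that $\alpha(mn, mk) = m^2 \alpha(n,k)$ (identically) and $\alpha(0,k) = k^2$. For integers $n\ge 0$ define \[ A^{(\lambda,\mu)}_q(n) = \sum_{k=0}^n q^{\alpha(n,k)} \binom{n}{k}_q^{\lambda}\binom{n+k}{k}_q^{\mu}. \] Then for every positive integer $m$ and every integer $n\ge 0$, \[ A^{(\lambda,\mu)}_q(mn) \equiv A^{(\lambda,\mu)}_{q^{m^2}}(n) - \frac{m^2-1}{12}(q^m-1)^2 R^{(\lambda,\mu)}(n) \pmod{\Phi_m(q)^3}, \] where $A^{(\lambda,\mu)}_{q^{m^2}}(n)$ is $A^{(\lambda,\mu)}_q(n)$ with $q$ replaced by $q^{m^2}$, and \[ R^{(\lambda,\mu)}(n) = \sum_{k = 0}^{n} c^{(\lambda,\mu)}_{n,k}\binom{n}{k}^{\lambda}\binom{n+k}{k}^{\mu}, \qquad c^{(\lambda,\mu)}_{n,k} = \begin{cases} n^2 + (\mu-2)\frac{nk}{2}, & \lambda = 2,\\ ((\lambda+\mu)n - \lambda k)\frac{k}{2}, & \lambda > 2.\end{cases} \]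
   Context: $[n]_q = 1+q+\cdots+q^{n-1}$, $[n]_q! = [n]_q\cdots[1]_q$, and for $0\le k\le n$, $\binom{n}{k}_q = \frac{[n]_q!}{[k]_q![n-k]_q!}$. $\Phi_m(q)$ is the $m$th cyclotomic polynomial. A congruence $f\equiv g \pmod{\varphi(q)}$ means $f-g = h\varphi$ for some $h \in \mathbb{Q}[q^{\pm1}]$. *)

(* Defs.v *)
From mathcomp Require Import all_boot all_order all_algebra all_field.
From mathcomp Require Import mpoly.

Set Implicit Arguments.
Unset Strict Implicit.
Unset Printing Implicit Defensive.

Import GRing.Theory.
Local Open Scope ring_scope.

(* The q-analogs are evaluated at an arbitrary element x of a field, so that
   replacing q by q^(m^2) is evaluation at x = q^(m^2). *)

Definition qint (F : fieldType) (x : F) (n : nat) : F := \sum_(i < n) x ^+ i.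

Definition qfact (F : fieldType) (x : F) (n : nat) : F :=
  \prod_(i < n) qint x i.+1.

(* Meaningful for k <= n and [i]_x nonzero for 0 < i <= n. *)
Definition qbinom (F : fieldType) (x : F) (n k : nat) : F :=
  qfact x n / (qfact x k * qfact x (n - k)).

Definition eval2 (p : {mpoly int[2]}) (a b : int) : int :=
  p.@[tnth [tuple a; b]].

Definition subst2 (p a b : {mpoly int[2]}) : {mpoly int[2]} :=
  p \mPo [tuple a; b].

Definition varn : {mpoly int[2]} := 'X_ord0.
Definition vark : {mpoly int[2]} := 'X_ord_max.

(* The exponent is an integer, possibly negative, hence Laurent polynomials. *)
Definition qA (F : fieldType) (alpha : {mpoly int[2]}) (lambda mu : nat)
    (x : F) (n : nat) : F :=
  \sum_(k < n.+1)
    x ^ eval2 alpha n%:Z k%:Z * qbinom x n k ^+ lambda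
      * qbinom x (n + k) k ^+ mu.

Definition coefc (lambda mu n k : nat) : rat :=
  if lambda == 2%N then n%:R ^+ 2 + (mu%:R - 2) * (n%:R * k%:R / 2)
  else ((lambda%:R + mu%:R) * n%:R - lambda%:R * k%:R) * (k%:R / 2).

Definition sumR (lambda mu n : nat) : rat :=
  \sum_(k < n.+1)
    coefc lambda mu n k * 'C(n, k)%:R ^+ lambda * 'C(n + k, k)%:R ^+ mu.

(* The field Q(q), in which Q[q, q^-1] is the subring of the fractions
   p / q^d with p a polynomial. *)
Definition Qq : fieldType := {fraction {poly rat}}.

Definition polyq (p : {poly rat}) : Qq := tofrac p.

Definition q : Qq := polyq 'X.

Definition constq (c : rat) : Qq := polyq c%:P.

Definition is_laurent (h : Qq) : Prop :=
  exists (p : {poly rat}) (d : nat), h = polyq p / q ^+ d.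

Definition congr_laurent (f g phi : Qq) : Prop :=
  exists2 h : Qq, is_laurent h & f - g = h * phi.

Definition Phiq (m : nat) : Qq := polyq (map_poly intr ('Phi_m : {poly int})).

(* Main.v *)
Require Import Defs.
From mathcomp Require Import all_boot all_order all_algebra all_field.
From mathcomp Require Import mpoly.
From mathcomp Require Import ring zify.
Set Implicit Arguments.
Unset Strict Implicit.
Unset Printing Implicit Defensive.

Import GRing.Theory Num.Theory.
Local Open Scope ring_scope.

(* Fix a primitive m-th root of unity z and write w = q^m - 1.  Since Phi_m is
   squarefree over algC, it suffices to work modulo (q - z)^3 for each z, and
   w vanishes at z.
   The terms k = m j are handled by Straub's congruence
     [mn choose mk]_q = [n choose k]_{q^(m^2)} (1 - k(n-k) (m^2-1)/24 w^2).
   Splitting the q-factorial of m n into blocks of length m, it reduces to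
   the values at t = q^(ml) of f(t) = prod_(0 < r < m) (t - q^r).  At q = z,
   f(t) is 1 + t + ... + t^(m-1), which gives the Taylor coefficients of f at
   t = 1 to lowest order; the linear one is needed to one more order, and is
   obtained from the symmetry r -> m - r.
   The terms k = m j + r with 0 < r < m are divisible by w^lambda, so they
   only matter for lambda = 2, where q-Lucas at z and
   sum_(0 < r < m) z^r / (z^r - 1)^2 = - (m^2 - 1) / 12 give their sum. *)

(** * Gaussian binomials *)

Section GaussianBinomials.

Variable R : comNzRingType.
Implicit Types (x : R) (n k l : nat).

(** The Pascal recursion needs no division, so this form makes sense at roots of unity and commutes
    with ring morphisms. *)
Fixpoint gbin x n k : R :=
  match n, k with
  | _, 0 => 1
  | 0, _.+1 => 0
  | n'.+1, k'.+1 => gbin x n' k' + x ^+ k'.+1 * gbin x n' k'.+1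
  end.

Definition gfact x n : R := \prod_(i < n) (x ^+ i.+1 - 1).

Lemma gbin0 x n : gbin x n 0 = 1.
Proof. by case: n. Qed.

Lemma gbinS x n k :
  gbin x n.+1 k.+1 = gbin x n k + x ^+ k.+1 * gbin x n k.+1.
Proof. by []. Qed.

Lemma gbin_small x n k : (n < k)%N -> gbin x n k = 0.
Proof.
elim: n k => [|n IHn] [|k] //= ltnk.
by rewrite !IHn ?mulr0 ?addr0 // ltnW.
Qed.

Lemma gbinn x n : gbin x n n = 1.
Proof. by elim: n => //= n ->; rewrite gbin_small // mulr0 addr0. Qed.

Lemma gbin_at1 n k : gbin 1 n k = 'C(n, k)%:R.
Proof.
elim: n k => [|n IHn] [|k] //=.
by rewrite !IHn expr1n mul1r binS natrD addrC.
Qed.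

Lemma gfactS x n : gfact x n.+1 = gfact x n * (x ^+ n.+1 - 1).
Proof. by rewrite /gfact big_ord_recr. Qed.

Lemma gfact0 x : gfact x 0 = 1.
Proof. by rewrite /gfact big_ord0. Qed.

Lemma gbin_gfact x k l :
  gbin x (k + l) k * (gfact x k * gfact x l) = gfact x (k + l).
Proof.
have [n] := ubnP (k + l); elim: n k l => // n IHn [|k] [|l] ltn.
- by rewrite gbin0 gfact0 !mulr1.
- by rewrite gbin0 gfact0 !mul1r.
- by rewrite addn0 gbinn gfact0 mulr1 mul1r.
have := IHn k.+1 l ltac:(lia); have := IHn k l.+1 ltac:(lia).
rewrite addSn !addnS addSn (gbinS _ _.+1) !gfactS => H1 H2.
have -> : x ^+ (k + l).+2 = x ^+ k.+1 * x ^+ l.+1.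
  by rewrite -exprD addSn addnS.
(* The two Pascal terms match the two induction hypotheses, and their prefactors add up to
   [x ^+ (k + l).+2 - 1]. *)
transitivity ((x ^+ k.+1 - 1) * (gbin x (k + l).+1 k *
    (gfact x k * (gfact x l * (x ^+ l.+1 - 1))))
  + x ^+ k.+1 * (x ^+ l.+1 - 1) * (gbin x (k + l).+1 k.+1 *
    (gfact x k * (x ^+ k.+1 - 1) * gfact x l))); first by ring.
rewrite H1 H2; ring.
Qed.

End GaussianBinomials.

Lemma rmorph_gbin (R S : comNzRingType) (f : {rmorphism R -> S}) x n k :
  f (gbin x n k) = gbin (f x) n k.
Proof.
elim: n k => [|n IHn] [|k] /=; rewrite ?rmorph1 ?rmorph0 //.
by rewrite rmorphD rmorphM rmorphXn /= !IHn.
Qed.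

Lemma gfact_neq0 (R : idomainType) (x : R) n :
  (forall i, (0 < i <= n)%N -> x ^+ i != 1) -> gfact x n != 0.
Proof.
by move=> x1; apply/prodf_neq0 => i _; rewrite subr_eq0 x1 ?ltn_ord.
Qed.

(** The q-factorials can be cancelled because [x] is not a root of unity. With [x] the
    indeterminate, the factor [x ^+ n.+1 - 1] brought out here later supplies a factor [w]. *)
Lemma gbin_absorb (R : idomainType) (x : R) n k :
  (forall i, (0 < i)%N -> x ^+ i != 1) -> (k <= n)%N ->
  gbin x n.+1 k.+1 * (x ^+ k.+1 - 1) = (x ^+ n.+1 - 1) * gbin x n k.
Proof.
move=> x1 lekn; have [l ->] : exists l, n = (k + l)%N by exists (n - k)%N; lia.
have g0 j : gfact x j != 0 by apply: gfact_neq0 => i /andP[/x1].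
apply: (mulIf (mulf_neq0 (g0 k) (g0 l))).
have := gbin_gfact x k.+1 l; rewrite addSn !gfactS -gbin_gfact => H.
transitivity (gbin x (k + l).+1 k.+1 *
   (gfact x k * (x ^+ k.+1 - 1) * gfact x l)); [ring | rewrite H; ring].
Qed.

Lemma qfact_gfact (F : fieldType) (x : F) n :
  (x - 1) ^+ n * qfact x n = gfact x n.
Proof.
elim: n => [|n IHn]; first by rewrite /qfact gfact0 big_ord0 mulr1.
rewrite gfactS -IHn /qfact big_ord_recr /= subrX1 /qint exprS; ring.
Qed.

Lemma qbinom_gbin (F : fieldType) (x : F) n k :
  (forall i, (0 < i)%N -> x ^+ i != 1) -> (k <= n)%N ->
  qbinom x n k = gbin x n k.
Proof.
move=> x1 lekn; have [l ->] : exists l, n = (k + l)%N by exists (n - k)%N; lia.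
have x1n0 : x - 1 != 0 by rewrite subr_eq0 -[x]expr1 x1.
have q0 j : qfact x j != 0.
  have : gfact x j != 0 by apply: gfact_neq0 => i /andP[/x1].
  by rewrite -qfact_gfact mulf_eq0 negb_or => /andP[].
have := gbin_gfact x k l; rewrite -!qfact_gfact exprD => H.
rewrite /qbinom addKn; apply: (canLR (mulfK (mulf_neq0 (q0 _) (q0 _)))).
apply: (mulfI (mulf_neq0 (expf_neq0 k x1n0) (expf_neq0 l x1n0))).
by rewrite -H; ring.
Qed.

(** * The q-Lucas theorem at a primitive root of unity *)

Section Lucas.

Variables (F : fieldType) (m : nat) (z : F).
Hypotheses (m_gt0 : (0 < m)%N) (zP : m.-primitive_root z).

Lemma prim_expr_neq1 i : (0 < i < m)%N -> z ^+ i != 1.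
Proof.
case/andP=> i0 im; rewrite -(prim_order_dvd zP).
by apply/negP => /dvdn_leq -/(_ i0); rewrite leqNgt im.
Qed.

(** The last factor [z ^+ m - 1] of [gfact z m] is zero, whereas the q-factorials of [d] and [m - d]
    are not. *)
Lemma gbin_prim_eq0 d : (0 < d < m)%N -> gbin z m d = 0.
Proof.
case/andP=> d0 dm; have := gbin_gfact z d (m - d).
rewrite subnKC 1?ltnW // -{3}(prednK m_gt0) gfactS prednK //.
rewrite (prim_expr_order zP) subrr mulr0 => /eqP.
rewrite !mulf_eq0 => /or3P[/eqP//||] /negPn/negP[];
  apply: gfact_neq0 => i Hi; apply: prim_expr_neq1; lia.
Qed.

Lemma gbin_lucas n k :
  gbin z n k = 'C(n %/ m, k %/ m)%:R * gbin z (n %% m) (k %% m).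
Proof.
elim: n k => [|n IHn] [|k].
- by rewrite div0n mod0n !gbin0 bin0 mulr1.
- rewrite div0n mod0n bin0n modnS; case: ifP => [dvd|]; last by rewrite mulr0.
  by rewrite -leqn0 leqNgt divn_gt0 // (dvdn_leq _ dvd) // mul0r.
- by rewrite div0n mod0n !gbin0 bin0 mulr1.
rewrite gbinS !IHn -(prim_expr_mod zP k.+1) !modnS !divnS //.
have modm j : (m %| j.+1 -> j %% m = m.-1)%N.
  case/dvdnP=> [[|t]] // jE; have -> : j = (t * m + m.-1)%N by lia.
  by rewrite modnMDl modn_small ?prednK.
have ltm j : ~~ (m %| j.+1)%N -> ((j %% m).+1 < m)%N.
  move=> /negPf ndvd; have := modnS j m; rewrite ndvd => <-.
  exact: ltn_pmod.
(* If [m] divides both successors, the recursion becomes the Pascal rule for the quotients. If it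
   divides only [n.+1], both sides vanish, the left one by [gbin_prim_eq0]. If it divides only
   [k.+1], the first Pascal term vanishes because [k %% m = m.-1] exceeds [n %% m]. Otherwise the
   recursion happens in the remainders. *)
have [dn|Ndn] := boolP (m %| n.+1)%N; have [dk|Ndk] := boolP (m %| k.+1)%N.
- by rewrite !modm // gbinn !gbin0 expr0 !add1n binS natrD; ring.
- rewrite modm // [RHS]mulr0 add0n mulrCA -mulrDr -gbinS prednK //.
  by rewrite gbin_prim_eq0 ?mulr0 ?ltm.
- rewrite (modm k) // [gbin _ _ m.-1]gbin_small; last first.
    by rewrite -ltnS prednK // ltm.
  by rewrite !gbin0 expr0 add1n add0n; ring.
by rewrite /= !add0n; ring.
Qed.

(** The vanishing of [gbin z m r.+1] and the Pascal recursion give the value [(-1)^r z^(-r(r+1)/2)];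
    squaring removes the sign and the halved exponent. *)
Lemma gbin_pred_sqr r :
  (r < m)%N -> gbin z m.-1 r ^+ 2 * z ^+ (r * r.+1) = 1.
Proof.
elim: r => [|r IHr] rm; first by rewrite gbin0 mul0n !mulr1 expr1n.
have := gbin_prim_eq0 (d := r.+1) rm.
rewrite -{1}(prednK m_gt0) gbinS => /eqP; rewrite addr_eq0 => /eqP H.
have := IHr (ltnW rm); rewrite H => <-.
have -> : (r.+1 * r.+2 = r.+1 + r.+1 + r * r.+1)%N by lia.
rewrite !exprD; ring.
Qed.

End Lucas.

(** * Congruences modulo powers of X - z *)

Section Congruences.

Variables (F : fieldType) (z : F).
Implicit Types (k : nat) (f g h w : {poly F}).

Definition cong k f g := ('X - z%:P) ^+ k %| f - g.

Lemma congE k f g : cong k f g = (('X - z%:P) ^+ k %| f - g).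
Proof. by []. Qed.

Lemma congxx k f : cong k f f.
Proof. by rewrite /cong subrr dvdp0. Qed.

Lemma cong_sym k f g : cong k f g -> cong k g f.
Proof. by rewrite /cong -[f - g]opprB dvdpNr. Qed.

Lemma cong_trans k f g h : cong k f g -> cong k g h -> cong k f h.
Proof.
rewrite /cong => fg gh; have -> : f - h = (f - g) + (g - h) by ring.
exact: dvdp_add.
Qed.

Lemma congD k f f' g g' :
  cong k f f' -> cong k g g' -> cong k (f + g) (f' + g').
Proof. by rewrite /cong opprD addrACA; apply: dvdp_add. Qed.

Lemma congN k f g : cong k f g -> cong k (- f) (- g).
Proof. by rewrite /cong -opprD dvdpNr. Qed.

Lemma congB k f f' g g' :
  cong k f f' -> cong k g g' -> cong k (f - g) (f' - g').
Proof.
by move=> ff' gg'; apply: congD ff' (congN gg').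
Qed.

Lemma congM k f f' g g' :
  cong k f f' -> cong k g g' -> cong k (f * g) (f' * g').
Proof.
rewrite /cong => ff' gg'.
have -> : f * g - f' * g' = (f - f') * g + f' * (g - g') by ring.
by apply: dvdp_add; [apply: dvdp_mulr | apply: dvdp_mull].
Qed.

Lemma congMl k h f g : cong k f g -> cong k (h * f) (h * g).
Proof. exact/congM/congxx. Qed.

Lemma congMr k h f g : cong k f g -> cong k (f * h) (g * h).
Proof. by move=> fg; apply: congM fg (congxx _ _). Qed.

Lemma congMC k h a b : a = b -> cong k (h * a%:P) (h * b%:P).
Proof. by move->; apply: congxx. Qed.

Lemma congX k f g n : cong k f g -> cong k (f ^+ n) (g ^+ n).
Proof.
move=> fg; elim: n => [|n IHn]; first exact: congxx.
by rewrite !exprS; apply: congM.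
Qed.

Lemma cong_sum k (I : Type) (r : seq I) (P : pred I) (f g : I -> {poly F}) :
  (forall i, P i -> cong k (f i) (g i)) ->
  cong k (\sum_(i <- r | P i) f i) (\sum_(i <- r | P i) g i).
Proof.
move=> fg; elim/big_rec2: _ => [|i x y Pi xy]; first exact: congxx.
by apply: congD xy; apply: fg.
Qed.

(** A polynomial that does not vanish at [z] is coprime to the modulus. *)
Lemma cong_cancel k h f g :
  h.[z] != 0 -> cong k (h * f) (h * g) -> cong k f g.
Proof.
move=> hz; rewrite /cong -mulrBr Gauss_dvdpr //.
by rewrite coprimep_expl // coprimep_sym coprimep_XsubC /root.
Qed.

Lemma cong1E f g : cong 1 f g = (f.[z] == g.[z]).
Proof.
by rewrite /cong expr1 dvdp_XsubCl rootE hornerD hornerN subr_eq0.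
Qed.

Lemma cong1C f : cong 1 f (f.[z])%:P.
Proof. by rewrite cong1E hornerC. Qed.

(** Each factor [w] contributes one order of vanishing at [z]. In particular, a cofactor of [w ^+ 2]
    matters modulo the cube only through its value at [z]. *)
Lemma cong_shift i k w f g :
  w.[z] = 0 -> cong k f g -> cong (i + k) (w ^+ i * f) (w ^+ i * g).
Proof.
move=> wz; rewrite /cong -mulrBr exprD => fg; apply: dvdp_mul => //.
by apply: dvdp_exp2r; rewrite dvdp_XsubCl; apply/rootP.
Qed.

Lemma cong_exp0 i w f : w.[z] = 0 -> cong i (w ^+ i * f) 0.
Proof.
move=> wz; rewrite -[X in cong X _ _]addn0 -[0](mulr0 (w ^+ i)).
by apply: cong_shift => //; rewrite /cong expr0 dvd1p.
Qed.

Lemma cong_scalar w f :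
  w.[z] = 0 -> cong 3 (w ^+ 2 * f) (w ^+ 2 * (f.[z])%:P).
Proof. by move=> wz; apply: (@cong_shift 2 1) => //; apply: cong1C. Qed.

Lemma cong_1subM w (x y : F) : w.[z] = 0 ->
  cong 3 ((1 - x%:P * w ^+ 2) * (1 - y%:P * w ^+ 2)) (1 - (x + y)%:P * w ^+ 2).
Proof.
move=> wz; rewrite /cong.
have -> : (1 - x%:P * w ^+ 2) * (1 - y%:P * w ^+ 2) - (1 - (x + y)%:P * w ^+ 2)
   = w ^+ 3 * (w * (x * y)%:P) - 0 by rewrite polyCD polyCM; ring.
exact: cong_exp0.
Qed.

End Congruences.

(** * Taylor expansions at 1 *)

Lemma coef_XaddC1_exp (R : comNzRingType) n i :
  (('X + 1 : {poly R}) ^+ n)`_i = 'C(n, i)%:R.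
Proof.
elim: n i => [|n IHn] i; first by rewrite expr0 coef1 bin0n eq_sym; case: i.
rewrite exprS mulrDl mul1r coefD coefXM !IHn.
by case: i => [|i] /=; rewrite ?bin0 ?add0r // binS natrD addrC.
Qed.

(** The shifted geometric sum is [((X + 1)^m - 1) / X]. *)
Lemma coef_geom_comp (R : comNzRingType) m i :
  ((\sum_(j < m) 'X^j) \Po ('X + 1 : {poly R}))`_i = 'C(m, i.+1)%:R.
Proof.
elim: m i => [|m IHm] i; first by rewrite big_ord0 comp_poly0 coef0.
rewrite big_ord_recr /= comp_polyD coefD IHm comp_Xn_poly coef_XaddC1_exp.
by rewrite binS natrD.
Qed.

(** The remainder stays explicit: with [R = {poly F}] and [u] a multiple of [w], its factor [u ^+ 3]
    makes it vanish modulo the cube. *)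
Lemma taylor_at1 (R : comNzRingType) (p : {poly R}) (c := (p \Po ('X + 1))) :
  exists g : {poly R}, forall u,
    p.[1 + u] = c`_0 + c`_1 * u + c`_2 * u ^+ 2 + u ^+ 3 * g.[u].
Proof.
exists (drop_poly 3 c) => u.
have -> : p.[1 + u] = c.[u] by rewrite horner_comp !hornerE addrC.
rewrite -{1}(poly_take_drop 3 c) hornerD hornerM hornerXn [_ * u ^+ 3]mulrC.
congr (_ + _); rewrite /take_poly horner_poly !big_ord_recr big_ord0 /=.
by rewrite add0r expr0 mulr1 expr1.
Qed.

Lemma geom_taylor_at1 (R : comNzRingType) m : exists g : {poly R}, forall u,
  \sum_(i < m) (1 + u) ^+ i
  = m%:R + 'C(m, 2)%:R * u + 'C(m, 3)%:R * u ^+ 2 + u ^+ 3 * g.[u].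
Proof.
have [g Hg] := taylor_at1 (\sum_(i < m) 'X^i : {poly R}); exists g => u.
rewrite -[m in m%:R]bin1 -!coef_geom_comp -Hg horner_sum.
by apply: eq_bigr => i _; rewrite hornerXn.
Qed.

Lemma natr_bin2 (F : numFieldType) n : 'C(n, 2)%:R = n%:R * (n%:R - 1) / 2 :> F.
Proof.
elim: n => [|n IHn]; first by rewrite !mul0r.
by rewrite binS natrD IHn bin1 -natr1; field.
Qed.

Lemma natr_bin3 (F : numFieldType) n :
  'C(n, 3)%:R = n%:R * (n%:R - 1) * (n%:R - 2) / 6 :> F.
Proof.
elim: n => [|n IHn]; first by rewrite !mul0r.
by rewrite binS natrD IHn natr_bin2 -natr1; field.
Qed.

(** * Straub's congruence *)

Section PrimitiveRoot.

Variables (F : numFieldType) (m : nat) (z : F).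
Hypotheses (m_gt0 : (0 < m)%N) (zP : m.-primitive_root z).

Local Notation K := {poly F}.
Local Notation cong := (cong z).

(** The product [f] of the overview: [t] is the outer variable, and [q] is the variable of the
    coefficient ring [K]. *)
Definition halfprod : {poly K} := \prod_(1 <= r < m) ('X - ('X^r)%:P).

Local Notation w := ('X^m - 1 : K).
Local Notation p := (halfprod \Po ('X + 1)).
Local Notation kappa := ((m%:R ^+ 2 - 1) / 24 : F).

Lemma w_root : w.[z] = 0.
Proof. by rewrite !hornerE (prim_expr_order zP) subrr. Qed.

Lemma m_neq0 : m%:R != 0 :> F.
Proof. by rewrite pnatr_eq0 -lt0n. Qed.

Lemma geom_prim_root :
  \sum_(i < m) 'X^i = \prod_(1 <= r < m) ('X - (z ^+ r)%:P) :> {poly F}.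
Proof.
have X1 : 'X - 1%:P != 0 :> {poly F} by rewrite polyXsubC_eq0.
apply: (mulfI X1); rewrite -subrX1 -(factor_Xn_sub_1 zP).
by rewrite big_ltn // expr0.
Qed.

Lemma halfprod_at_root : map_poly (horner_eval z) halfprod = \sum_(i < m) 'X^i.
Proof.
rewrite geom_prim_root rmorph_prod /=.
apply: eq_bigr => r _; rewrite rmorphB /= map_polyX map_polyC /=.
by rewrite /horner_eval hornerXn.
Qed.

Lemma halfprod_coef i : (p`_i).[z] = 'C(m, i.+1)%:R.
Proof.
rewrite -[LHS]/(horner_eval z p`_i) -coef_map map_comp_poly /=.
by rewrite halfprod_at_root rmorphD /= map_polyX rmorph1 coef_geom_comp.
Qed.

Lemma halfprod1_coef : halfprod.[1] = p`_0.
Proof.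
by have [g Hg] := taylor_at1 halfprod; have := Hg 0; rewrite addr0 => ->; ring.
Qed.

(* The substitution r -> m - r turns the product over (Q - q^r) into a unit
   times the product over (1 - q^r); this functional equation determines the
   linear Taylor coefficient to second order. *)
Lemma halfprod_reflect :
  exists2 c : K, halfprod.['X^m] = c * halfprod.[1] &
    c ^+ 2 = 'X^m ^+ m.-1 /\ c.[z] = 1.
Proof.
pose c : K := \prod_(1 <= r < m) - 'X^r.
have rev (G : nat -> K) :
  \prod_(1 <= r < m) G r = \prod_(1 <= r < m) G (m - r)%N.
  by rewrite big_nat_rev /= add1n; apply: eq_bigr => i _; rewrite subSS.
have E : halfprod.['X^m] = c * halfprod.[1].
  rewrite !horner_prod (rev (fun r => ('X - ('X^r)%:P).[1])) -big_split /=.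
  apply: eq_big_nat => r /andP[r0 rm]; rewrite !hornerE.
  by rewrite -{1}(subnKC (ltnW rm)) exprD; ring.
exists c => //; split.
  rewrite expr2 {2}/c (rev (fun r => - 'X^r)) -big_split /=.
  rewrite (eq_big_nat _ _ (F2 := fun=> 'X^m)).
    by rewrite prodr_const_nat subn1.
  by move=> r /andP[r0 rm]; rewrite mulrNN -exprD subnKC 1?ltnW.
(* At [q = z] the arguments [q^m] and 1 coincide, and the common value [m] is nonzero; hence [c.[z]
   = 1]. *)
have hz (x : K) : halfprod.[x].[z] = \prod_(1 <= r < m) (x.[z] - z ^+ r).
  rewrite horner_prod -[LHS]/(horner_eval z _) rmorph_prod /=.
  by apply: eq_bigr => r _; rewrite /horner_eval !hornerE.
have : halfprod.['X^m].[z] = halfprod.[1].[z].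
  by rewrite !hz hornerXn (prim_expr_order zP) hornerE.
rewrite E hornerM halfprod1_coef halfprod_coef bin1 -[X in _ = X]mul1r.
exact/mulIf/m_neq0.
Qed.

Lemma cong_binomial n :
  cong 3 ('X^m ^+ n) (1 + (n%:R)%:P * w + ('C(n, 2)%:R)%:P * w ^+ 2).
Proof.
have [g Hg] := taylor_at1 ('X^n : {poly K}).
have := Hg w; rewrite comp_Xn_poly !coef_XaddC1_exp hornerXn addrC subrK => ->.
rewrite bin0 bin1 !rmorph_nat congE addrAC subrr add0r.
by have := cong_exp0 3 g.[w] w_root; rewrite congE subr0.
Qed.

Lemma geom_root l : (\sum_(i < m) ('X^m ^+ l : K) ^+ i).[z] = m%:R.
Proof.
rewrite horner_sum (eq_bigr (fun=> 1)) => [|i _].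
  by rewrite sumr_const card_ord.
by rewrite !horner_exp hornerX (prim_expr_order zP) !expr1n.
Qed.

(** Both factors are expanded at [1 + w v], where [v] has value [l] at [z]. Divided by their
    constant terms, the two expansions differ to the needed order only in the linear coefficient, by
    [- kappa w]. *)
Lemma halfprod_cong l :
  cong 3 (m%:R * halfprod.['X^m ^+ l])
    (halfprod.[1] * ((\sum_(i < m) ('X^m ^+ l) ^+ i)
       * (1 - (kappa * l%:R)%:P * w ^+ 2))).
Proof.
have [c fQ [c2 cz]] := halfprod_reflect.
(* [a] and [a2] are ['C(m, 2) / m] and ['C(m, 3) / m], the Taylor coefficients of the geometric sum
   over its constant term. *)
pose a : F := (m%:R - 1) / 2.
pose a2 : F := (m%:R - 1) * (m%:R - 2) / 6.
have mE : m%:R = m.-1%:R + 1 :> F by rewrite natr1 prednK.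
(* [c] is a square root of [(1 + w)^(m-1)], and [a] and [a2 - kappa = (m-1)(m-3)/8] are the binomial
   coefficients for the exponent [(m-1)/2]. *)
have c_cong : cong 3 c (1 + a%:P * w + (a2 - kappa)%:P * w ^+ 2).
  set c' := (X in cong 3 c X).
  have c'z : c'.[z] = 1 by rewrite /c' !hornerD !hornerM !hornerC w_root; ring.
  (* [c + c'] has value 2 at [z], so it is enough to compare squares; this also fixes the sign of
     the root. *)
  apply: (@cong_cancel _ _ _ (c + c')).
    by rewrite hornerD cz c'z -mulr2n pnatr_eq0.
  suff : cong 3 (c ^+ 2) (c' ^+ 2).
    rewrite !congE; set E := (X in X %| _ -> _) => Ed.
    by have -> : (c + c') * c - (c + c') * c' = c ^+ 2 - c' ^+ 2 by ring.
  rewrite c2; apply: cong_trans (cong_binomial _) _; apply: cong_sym.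
  have aE : (m.-1%:R)%:P = a%:P + a%:P :> K.
    by rewrite -polyCD; congr _%:P; rewrite /a mE; field.
  have bE : ('C(m.-1, 2)%:R)%:P
      = a%:P ^+ 2 + (a2 - kappa)%:P + (a2 - kappa)%:P :> K.
    rewrite -polyC_exp -!polyCD natr_bin2; congr _%:P.
    by rewrite /a /a2 mE; field.
  rewrite aE bE congE; set b := (a2 - kappa)%:P; set t := (X in _ %| X).
  have -> : t = w ^+ 3 * (a%:P * b + a%:P * b + b ^+ 2 * w) - 0.
    by rewrite /t /c' -/b; ring.
  by apply: cong_exp0; apply: w_root.
have mK : m%:R = (m%:R)%:P :> K by rewrite rmorph_nat.
have S1E : 'C(m, 2)%:R = m%:R * a%:P :> K.
  by rewrite mK -polyCM -(rmorph_nat (@polyC F)) natr_bin2 /a; congr _%:P; ring.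
have S2E : 'C(m, 3)%:R = m%:R * a2%:P :> K.
  by rewrite mK -polyCM -(rmorph_nat (@polyC F)) natr_bin3 /a2; congr _%:P; ring.
have [g Hg] := taylor_at1 halfprod.
have [gS HgS] := geom_taylor_at1 K m.
pose v : K := \sum_(i < l) 'X^m ^+ i.
have vz : v.[z] = l%:R.
  rewrite horner_sum (eq_bigr (fun=> 1)) => [|i _].
    by rewrite sumr_const card_ord.
  by rewrite !horner_exp hornerX (prim_expr_order zP) !expr1n.
have Ql : 'X^m ^+ l = 1 + w * v by rewrite -subrX1 addrC subrK.
have := Hg w; have := Hg (w * v); rewrite -Ql => fQl.
(* [T] is the expansion at [t = q^m]; together with [c_cong] it determines the linear Taylor
   coefficient to second order. *)
rewrite [1 + w]addrC subrK fQ halfprod1_coef => T.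
have := HgS (w * v).
rewrite -Ql S1E S2E => ->; rewrite fQl.
move: (p`_0) (p`_1) (p`_2) (halfprod_coef 0) (halfprod_coef 2) T.
move=> p0 p1 p2 p0z p2z T.
have t1 : cong 3 (c * p0) ((1 + a%:P * w + (a2 - kappa)%:P * w ^+ 2) * p0).
  exact: congMr.
have t2 : cong 3 (w ^+ 2 * p2) (w ^+ 2 * (a2%:P * p0)).
  apply: (@cong_shift _ _ 2 1); first exact: w_root.
  rewrite cong1E p2z hornerM hornerC p0z bin1 natr_bin3; apply/eqP.
  by rewrite /a2; ring.
have t3 : cong 3 (w ^+ 2 * (l%:R)%:P) (w ^+ 2 * v).
  apply: (@cong_shift _ _ 2 1); first exact: w_root.
  by rewrite cong1E hornerC vz.
move: (g.[_]) (g.[_]) (gS.[_]) T t1 => g1 g2 g3 T.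
(* [R] collects the Taylor remainders and the other terms carrying [w ^+ 3], so that the difference
   becomes an exact combination of [t1], [t2], [t3] and [t4]. *)
pose R := m%:R * (v ^+ 3 * g1 - v * g2) - p0 * v ^+ 3 * g3
  + p0 * kappa%:P * (l%:R)%:P * v * (m%:R * a%:P + m%:R * a2%:P * w * v
     + (w * v) ^+ 2 * g3).
have t4 : cong 3 (w ^+ 3 * R) 0 by apply: cong_exp0; apply: w_root.
move=> t1; rewrite !congE in t1 t2 t3 t4 *.
set E := (X in X %| _) in t1 t2 t3 t4 *.
set D := (X in E %| X).
suff -> : D = m%:R * v *
   (c * p0 - (1 + a%:P * w + (a2 - kappa)%:P * w ^+ 2) * p0)
   + m%:R * (v ^+ 2 - v) * (w ^+ 2 * p2 - w ^+ 2 * (a2%:P * p0))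
   + m%:R * p0 * kappa%:P * (w ^+ 2 * (l%:R)%:P - w ^+ 2 * v)
   + (w ^+ 3 * R - 0).
  by apply: dvdp_add t4; do 2?apply: dvdp_add; apply: dvdp_mull.
rewrite T /D /R (polyCM kappa) (polyCB a2); ring.
Qed.

End PrimitiveRoot.

(** * Splitting q-factorials into blocks of length [m] *)

Section StraubCongruence.

Variables (F : numFieldType) (m : nat) (z : F).
Hypotheses (m_gt0 : (0 < m)%N) (zP : m.-primitive_root z).

Local Notation K := {poly F}.
Local Notation cong := (cong z).
Local Notation w := ('X^m - 1 : K).
Local Notation kappa := ((m%:R ^+ 2 - 1) / 24 : F).

Definition geomprod n : K := \prod_(i < n) \sum_(j < m) ('X^m ^+ i.+1) ^+ j.

Definition halfprods n : K := \prod_(i < n) (halfprod F m).['X^m ^+ i.+1].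

Lemma gfact_pow n : gfact 'X^(m ^ 2) n = gfact 'X^m n * geomprod n.
Proof.
rewrite -big_split; apply: eq_bigr => i _ /=.
by rewrite -subrX1 -mulnn -!exprM -mulnA [(m * i.+1)%N]mulnC mulnA.
Qed.

(** In the last block, with [N = m * n.+1], the identity [X^r (X^(N-r) - 1) = X^N - X^r] produces
    the factors of [halfprod] at [X^N]; the exponent [N] itself goes to [gfact 'X^m]. *)
Lemma gfact_blocks n :
  (\prod_(1 <= r < m) 'X^r) ^+ n * gfact 'X (m * n)
  = gfact 'X^m n * halfprods n.
Proof.
elim: n => [|n IHn]; first by rewrite muln0 /halfprods !gfact0 big_ord0 !mulr1.
set c := \prod_(1 <= r < m) 'X^r in IHn *.
have -> : gfact 'X (m * n.+1)
    = gfact 'X (m * n) * \prod_(i < m) ('X^((m * n + i).+1) - 1) :> K.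
  by rewrite mulnSr /gfact big_split_ord.
suff step : c * (\prod_(i < m) ('X^((m * n + i).+1) - 1))
    = ('X^m ^+ n.+1 - 1) * (halfprod F m).['X^m ^+ n.+1].
  transitivity ((c ^+ n * gfact 'X (m * n))
    * (c * (\prod_(i < m) ('X^((m * n + i).+1) - 1)))).
    by rewrite exprS; ring.
  by rewrite IHn step gfactS /halfprods big_ord_recr /=; ring.
have rev (G : nat -> K) :
  \prod_(1 <= r < m) G r = \prod_(i < m.-1) G (m.-1 - i)%N.
  rewrite -{1}(prednK m_gt0) big_add1 /= big_mkord (reindex_inj rev_ord_inj).
  by apply: eq_bigr => i _ /=; congr G; have := ltn_ord i; lia.
have splitm (G : nat -> K) :
    \prod_(i < m) G i = (\prod_(i < m.-1) G i) * G m.-1.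
  by rewrite -!(big_mkord xpredT) -{1}(prednK m_gt0) big_nat_recr.
rewrite (splitm (fun i => 'X^((m * n + i).+1) - 1)).
have -> : (m * n + m.-1).+1 = (m * n.+1)%N by lia.
rewrite -exprM [RHS]mulrC mulrA; congr (_ * _).
rewrite /c horner_prod !rev -big_split; apply: eq_bigr => i _ /=.
rewrite mulrBr mulr1 -exprD !hornerE; congr ('X^ _ - _).
by have := ltn_ord i; lia.
Qed.

Lemma Xexp_neq1 i : (0 < i)%N -> 'X^i != 1 :> K.
Proof.
move=> i0; apply: contraTneq isT => /(congr1 (fun p : K => size p)).
by rewrite size_polyXn size_poly1 => -[] /eqP; rewrite -leqn0 leqNgt i0.
Qed.

Lemma gfact_Xexp_neq0 d n : (0 < d)%N -> gfact ('X^d : K) n != 0.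
Proof.
move=> d0; apply: gfact_neq0 => i /andP[i0 _].
by rewrite -exprM Xexp_neq1 // muln_gt0 d0.
Qed.

(** Both binomials are expressed through q-factorials; the powers of [q] and the factorials at
    ['X^m] cancel. *)
Lemma gbin_blocks k l :
  gbin 'X (m * (k + l)) (m * k)
    * (halfprods k * halfprods l * geomprod (k + l))
  = gbin 'X^(m ^ 2) (k + l) k
    * (halfprods (k + l) * geomprod k * geomprod l).
Proof.
have m2 : (0 < m ^ 2)%N by rewrite expn_gt0 m_gt0.
have g0 n : gfact ('X^(m ^ 2) : K) n != 0 by apply: gfact_Xexp_neq0.
apply: (mulIf (mulf_neq0 (g0 k) (g0 l))).
pose c : K := \prod_(1 <= r < m) 'X^r.
have H := gbin_gfact ('X : K) (m * k) (m * l); rewrite -mulnDr in H.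
have Hy := gbin_gfact ('X^(m ^ 2) : K) k l.
transitivity (c ^+ (k + l) * gfact 'X (m * (k + l))
   * (geomprod k * geomprod l * geomprod (k + l))).
  rewrite -H exprD !gfact_pow.
  transitivity (gbin 'X (m * (k + l)) (m * k) * (c ^+ k * gfact 'X (m * k)) *
    (c ^+ l * gfact 'X (m * l)) * (geomprod k * geomprod l * geomprod (k + l))).
    by rewrite !gfact_blocks; ring.
  by ring.
rewrite gfact_blocks.
transitivity (gfact 'X^(m ^ 2) (k + l)
   * (halfprods (k + l) * geomprod k * geomprod l)).
  by rewrite gfact_pow; ring.
by rewrite -Hy; ring.
Qed.

(** Product of [halfprod_cong] over [l = 1, ..., n]; the corrections add up to [1 + ... + n]. *)
Lemma halfprods_cong n :
  cong 3 (m%:R ^+ n * halfprods n)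
    ((halfprod F m).[1] ^+ n * geomprod n
      * (1 - (kappa * 'C(n.+1, 2)%:R)%:P * w ^+ 2)).
Proof.
elim: n => [|n IHn].
  rewrite /halfprods /geomprod !big_ord0 mulr0 mul0r subr0 !mulr1.
  exact: congxx.
have -> : m%:R ^+ n.+1 * halfprods n.+1 = (m%:R ^+ n * halfprods n)
    * (m%:R * (halfprod F m).['X^m ^+ n.+1]).
  by rewrite exprS /halfprods big_ord_recr /=; ring.
apply: cong_trans (congM IHn (halfprod_cong m_gt0 zP n.+1)) _.
have := cong_1subM (kappa * 'C(n.+1, 2)%:R) (kappa * n.+1%:R) (w_root zP).
rewrite -mulrDr -natrD (_ : _ + _ = 'C(n.+2, 2))%N; last first.
  by rewrite [RHS]binS bin1.
move=> H.
rewrite /geomprod big_ord_recr /= -/(geomprod n) (exprS _.[1]).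
move: H; move: (1 - _) (1 - _) (1 - _) (\sum_(j < m) _) => c b a s H.
have -> : (halfprod F m).[1] ^+ n * geomprod n * a *
    ((halfprod F m).[1] * (s * b))
  = (halfprod F m).[1] * (halfprod F m).[1] ^+ n * (geomprod n * s) * (a * b).
  ring.
exact: congMl.
Qed.

Lemma geomprod_root n : (geomprod n).[z] = m%:R ^+ n.
Proof.
rewrite /geomprod horner_prod (eq_bigr (fun=> m%:R)) => [|i _].
  by rewrite prodr_const card_ord.
exact: geom_root.
Qed.

(* Straub's q-analog of Ljunggren's congruence. *)
Lemma gbin_straub k l :
  cong 3 (gbin 'X (m * (k + l)) (m * k))
    (gbin 'X^(m ^ 2) (k + l) k * (1 - (kappa * (k * l)%:R)%:P * w ^+ 2)).
Proof.
pose x n : F := kappa * 'C(n.+1, 2)%:R.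
pose y n : K := 1 - (x n)%:P * w ^+ 2.
pose f1 := (halfprod F m).[1].
(* [U] gathers the factors common to both sides; its value at [z] is a power of [m], so it can be
   cancelled. *)
pose U := f1 ^+ (k + l) * (geomprod k * geomprod l * geomprod (k + l)).
have wz := w_root zP.
have f1z : f1.[z] = m%:R
  by rewrite /f1 halfprod1_coef (halfprod_coef m_gt0 zP) bin1.
have Uz : U.[z] != 0.
  by rewrite /U !hornerE !geomprod_root f1z !mulf_neq0 ?expf_neq0 //
    (m_neq0 F m_gt0).
have yC n : cong 3 (y n * (1 - (- x n)%:P * w ^+ 2)) 1.
  by have := cong_1subM (x n) (- x n) wz; rewrite subrr mul0r subr0.
have key : cong 3 (U * (gbin 'X (m * (k + l)) (m * k) * (y k * y l)))
                  (U * (gbin 'X^(m ^ 2) (k + l) k * y (k + l))).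
  have := congM (halfprods_cong k) (halfprods_cong l).
  move/(congMr (gbin 'X (m * (k + l)) (m * k) * geomprod (k + l))).
  set A := (X in cong 3 X _) => HA.
  have := congMr (gbin 'X^(m ^ 2) (k + l) k * geomprod k * geomprod l)
    (halfprods_cong (k + l)).
  set B := (X in cong 3 X _) => HB.
  have AB : A = B.
    have := gbin_blocks k l; rewrite /A /B exprD.
    move/(congr1 ( *%R (m%:R ^+ k * m%:R ^+ l))) => H.
    transitivity (m%:R ^+ k * m%:R ^+ l *
      (gbin 'X (m * (k + l)) (m * k) *
     (halfprods k * halfprods l * geomprod (k + l)))); first by ring.
    by rewrite H; ring.
  rewrite AB in HA; have := cong_trans (cong_sym HA) HB.
  rewrite -/f1 -/(x k) -/(x l) -/(x (k + l)) -/(y k) -/(y l) -/(y (k + l)).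
  set C := (X in cong 3 X _ -> _); set D := (X in cong 3 _ X -> _) => CD.
  have -> : U * (gbin 'X (m * (k + l)) (m * k) * (y k * y l)) = C.
    by rewrite /U /C exprD; ring.
  have -> : U * (gbin 'X^(m ^ 2) (k + l) k * y (k + l)) = D.
    by rewrite /U /D exprD; ring.
  exact: CD.
have {key} := cong_cancel Uz key.
move/(congMr ((1 - (- x k)%:P * w ^+ 2) * (1 - (- x l)%:P * w ^+ 2))) => key.
apply: cong_trans (cong_trans key _).
  apply: cong_sym.
  have := congMl (gbin 'X (m * (k + l)) (m * k)) (congM (yC k) (yC l)).
  rewrite !mulr1; congr cong; ring.
rewrite -mulrA; apply: congMl.
have := congM (congxx z 3 (y (k + l))) (cong_1subM (- x k) (- x l) wz).
move/cong_trans; apply.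
(* The exponent of the correction comes from ['C(k+l+1, 2) - 'C(k+1, 2) - 'C(l+1, 2) = k l]. *)
have := cong_1subM (x (k + l)%N) (- x k - x l) wz.
congr cong; congr (1 - _%:P * _).
by rewrite /x !natr_bin2 natrM -!natr1 natrD; field.
Qed.

End StraubCongruence.

(** * Expansion of the summands *)

(** Over the constant coefficient these are the elementary symmetric functions [e_1], [e_2] of the
    inverses, and Newton's identity gives [2 e_2 = e_1^2 - p_2] with [p_2] the sum of squares. *)
Lemma coef_prod_XaddC (F : fieldType) (I : eqType) (s : seq I) (y : I -> F)
    (P := \prod_(i <- s) ('X + (y i)%:P)) :
  (forall i, i \in s -> y i != 0) ->
  P`_1 = P`_0 * \sum_(i <- s) (y i)^-1 /\
  P`_2 *+ 2 = P`_0 * ((\sum_(i <- s) (y i)^-1) ^+ 2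
                      - \sum_(i <- s) (y i)^-1 ^+ 2).
Proof.
rewrite {}/P; elim: s => [_|i s IHs y0].
  by rewrite !big_nil !coef1 /= expr2 mul0r subrr !mulr0 mul0rn.
have yi : y i != 0 by rewrite y0 ?mem_head.
have [|IH1 IH2] := IHs; first by move=> j js; rewrite y0 // in_cons js orbT.
rewrite !big_cons; move: IH1 IH2; move: (\prod_(j <- s) _) => P.
move: (\sum_(j <- s) _) (\sum_(j <- s) _) => s2 s1 IH1 IH2.
rewrite !mulrDl !coefD !coefXM !coefCM /= add0r IH1; split; first by field.
by rewrite mulrnDl -(mulrnAr _ P`_2) IH2; field.
Qed.

Section RootSum.

Variables (F : numFieldType) (m : nat) (z : F).
Hypotheses (m_gt0 : (0 < m)%N) (zP : m.-primitive_root z).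

(** With [y = 1 - z^r] the summand is [y^-2 - y^-1], and the product of the [X + y] is the geometric
    sum shifted by 1, whose coefficients are binomial. *)
Lemma prim_root_sum :
  \sum_(1 <= r < m) z ^+ r / (z ^+ r - 1) ^+ 2 = - ((m%:R ^+ 2 - 1) / 12).
Proof.
have y0 r : r \in index_iota 1 m -> 1 - z ^+ r != 0.
  by rewrite mem_index_iota subr_eq0 eq_sym; apply: prim_expr_neq1.
have PE : \prod_(1 <= r < m) ('X + (1 - z ^+ r)%:P)
    = (\sum_(i < m) 'X^i) \Po ('X + 1 : {poly F}).
  rewrite (geom_prim_root m_gt0 zP) (rmorph_prod (comp_poly _)).
  apply: eq_bigr => r _.
  by rewrite [RHS]comp_polyB comp_polyX comp_polyC polyCB addrA.
have [] := coef_prod_XaddC y0; rewrite PE !coef_geom_comp bin1 natr_bin2 natr_bin3.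
set s1 := \sum_(_ <- _) _; set s2 := \sum_(_ <- _) _ => E1 E2.
have m0 := m_neq0 F m_gt0.
have {E1} s1E : s1 = (m%:R - 1) / 2 by apply: (mulfI m0); rewrite -E1; field.
have {E2} s2E : s2 = s1 ^+ 2 - (m%:R - 1) * (m%:R - 2) / 3.
  have -> : s2 = s1 ^+ 2 - (s1 ^+ 2 - s2) by ring.
  by congr (_ - _); apply: (mulfI m0); rewrite -E2; field.
transitivity (s2 - s1); last by rewrite s2E s1E; field.
rewrite /s1 /s2 -sumrB; apply: eq_big_seq => r /y0 yr.
have yr' : z ^+ r - 1 != 0 by rewrite -oppr_eq0 opprB.
by field; rewrite yr yr'.
Qed.

End RootSum.

(** The endpoint [m * n] starts no block, hence [n.+1] multiples of [m] against [n] blocks. *)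
Lemma sum_blocks (V : nmodType) (T : nat -> V) m n : (0 < m)%N ->
  \sum_(k < (m * n).+1) T k
  = \sum_(j < n.+1) T (m * j)%N
    + \sum_(j < n) \sum_(1 <= r < m) T (m * j + r)%N.
Proof.
move=> m0; rewrite !big_ord_recr /= [RHS]addrAC; congr (_ + _).
elim: n => [|n IHn]; first by rewrite muln0 !big_ord0 addr0.
rewrite mulnSr -(big_mkord xpredT) (@big_cat_nat _ _ _ (m * n)%N) ?leq_addr //=.
rewrite big_mkord IHn !big_ord_recr /= -!addrA; congr (_ + _).
rewrite [RHS]addrCA; congr (_ + _).
rewrite -{1}[(m * n)%N]add0n big_addn addKn big_ltn // add0n.
by congr (_ + _); apply: eq_bigr => r _; rewrite addnC.
Qed.

Section Terms.

Variables (F : numFieldType) (m : nat) (z : F).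
Hypotheses (m_gt0 : (0 < m)%N) (zP : m.-primitive_root z).

Local Notation K := {poly F}.
Local Notation cong := (cong z).
Local Notation w := ('X^m - 1 : K).
Local Notation kappa := ((m%:R ^+ 2 - 1) / 24 : F).

Lemma cong_1subX (x : F) n :
  cong 3 ((1 - x%:P * w ^+ 2) ^+ n) (1 - (n%:R * x)%:P * w ^+ 2).
Proof.
elim: n => [|n IHn].
  by rewrite mul0r mul0r subr0 expr0; apply: congxx.
rewrite exprS; apply: cong_trans (congMl _ IHn) _.
have -> : n.+1%:R * x = x + n%:R * x by rewrite -natr1; ring.
exact: cong_1subM (w_root zP).
Qed.

Lemma horner_gbin (x : K) n k : (gbin x n k).[z] = gbin x.[z] n k.
Proof. exact: (rmorph_gbin (horner_eval z)). Qed.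

Lemma gbin_Xsqr_root n k : (gbin 'X^(m ^ 2) n k : K).[z] = 'C(n, k)%:R.
Proof.
by rewrite horner_gbin hornerXn expnS exprM (prim_expr_order zP) expr1n gbin_at1.
Qed.

(** Straub's congruence is used for the pairs [(j, n - j)] and [(j, n)], and powers multiply its
    corrections by [lambda] and [mu]. The cofactor of [w ^+ 2] is then evaluated at [z]. *)
Lemma divisible_term lambda mu n j e d :
  (j <= n)%N -> z ^+ e = z ^+ d ->
  cong 3 ('X^e * gbin 'X (m * n) (m * j) ^+ lambda
            * gbin 'X (m * n + m * j) (m * j) ^+ mu)
    ('X^e * gbin 'X^(m ^ 2) n j ^+ lambda * gbin 'X^(m ^ 2) (n + j) j ^+ mu
     - w ^+ 2 * (z ^+ d * (kappa
          * ((lambda%:R * (n%:R - j%:R) + mu%:R * n%:R) * j%:R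
              * 'C(n, j)%:R ^+ lambda * 'C(n + j, j)%:R ^+ mu)))%:P).
Proof.
move=> jn zed.
have A1 := gbin_straub m_gt0 zP j (n - j).
rewrite subnKC // natrM natrB // in A1.
have A2 := gbin_straub m_gt0 zP j n; rewrite addnC mulnDr natrM in A2.
have := congM (congX lambda A1) (congX mu A2); rewrite !exprMn.
move: A1 A2 => _ _ A.
have B := congM (cong_1subX (kappa * (j%:R * (n%:R - j%:R))) lambda)
             (cong_1subX (kappa * (j%:R * n%:R)) mu).
have {B} := cong_trans B (cong_1subM _ _ (w_root zP)).
move: A; set G1 := gbin 'X _ _; set G2 := gbin 'X _ _.
set H1 := gbin _ _ _; set H2 := gbin _ _ _.
set x1 := (1 - _) ^+ _; set x2 := (1 - _) ^+ _; set c := (X in _ - X%:P * _).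
move=> A B.
apply: cong_trans (_ : cong 3 _ ('X^e * H1 ^+ lambda * H2 ^+ mu * (x1 * x2))) _.
  have := congMl 'X^e A; congr cong; ring.
apply: cong_trans (congMl _ B) _; rewrite mulrBr mulr1.
apply: congB (congxx _ _ _) _.
have -> : 'X^e * H1 ^+ lambda * H2 ^+ mu * (c%:P * w ^+ 2)
  = w ^+ 2 * ('X^e * H1 ^+ lambda * H2 ^+ mu * c%:P) by ring.
apply: cong_trans (cong_scalar _ (w_root zP)) _.
rewrite !hornerM !horner_exp hornerX hornerC zed !gbin_Xsqr_root /c.
by apply: congMC; ring.
Qed.

Lemma gbin_root n j r : (r < m)%N ->
  (gbin 'X (m * n + (m * j + r)) (m * j + r) : K).[z] = 'C(n + j, j)%:R.
Proof.
move=> rm; rewrite horner_gbin hornerX (gbin_lucas m_gt0 zP) addnA -mulnDr.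
by rewrite ![(m * _)%N]mulnC !divnMDl // !modnMDl divn_small // modn_small //
  addn0 gbinn mulr1 addn0.
Qed.

(** This exposes the factor [w]: it divides ['X^m ^+ n - 1], whereas ['X^(m * j + r) - 1] does not
    vanish at [z]. *)
Lemma gbin_nondiv n j r : (j < n)%N -> (0 < r < m)%N ->
  gbin 'X (m * n) (m * j + r) * ('X^(m * j + r) - 1)
  = ('X^m ^+ n - 1) * gbin 'X (m * n).-1 (m * j + r).-1 :> K.
Proof.
move=> jn rm; have k0 : (0 < m * j + r)%N by lia.
have n0 : (0 < m * n)%N by rewrite muln_gt0 m_gt0; lia.
rewrite -exprM -{1 2}(prednK k0) -{1 2}(prednK n0) gbin_absorb //.
  by move=> i; apply: Xexp_neq1.
rewrite -ltnS !prednK // (leq_trans (n := m * j.+1)) ?leq_mul //; last first.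
by rewrite mulnS addnC leq_add2r ltnW //; case/andP: rm.
Qed.

Lemma Xsub1_root j r : ('X^(m * j + r) - 1 : K).[z] = z ^+ r - 1.
Proof.
by rewrite !hornerE exprD exprM (prim_expr_order zP) expr1n mul1r.
Qed.

Lemma gbin_nondiv_root n j r : (j < n)%N -> (0 < r < m)%N ->
  (gbin 'X (m * n) (m * j + r) : K).[z] = 0.
Proof.
move=> jn rm; have := congr1 (horner^~ z) (gbin_nondiv jn rm).
rewrite !hornerM Xsub1_root hornerD hornerN hornerC horner_exp hornerXn.
rewrite (prim_expr_order zP) expr1n subrr mul0r => /eqP.
rewrite mulf_eq0 subr_eq0 (negPf (prim_expr_neq1 zP rm)) orbF.
by move/eqP.
Qed.

Lemma gbin_pred_root n j r : (j < n)%N -> (0 < r < m)%N ->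
  (gbin 'X (m * n).-1 (m * j + r).-1 : K).[z]
  = 'C(n.-1, j)%:R * gbin z m.-1 r.-1.
Proof.
move=> jn rm; rewrite horner_gbin hornerX (gbin_lucas m_gt0 zP).
have -> : ((m * n).-1 = n.-1 * m + m.-1)%N by case: n jn => //= n _; nia.
have -> : ((m * j + r).-1 = j * m + r.-1)%N by lia.
rewrite !divnMDl // !modnMDl !modn_small ?divn_small ?addn0 //; lia.
Qed.

(** Absorption in the squared binomial yields [w ^+ 2]. By q-Lucas the cofactor at [z] involves the
    square of [gbin z m.-1 r.-1], which is [z^(-r(r-1))] and reduces [z^(r^2)] to [z^r]. *)
Lemma nondivisible_term mu n j r e d :
  (j < n)%N -> (0 < r < m)%N -> z ^+ e = z ^+ (d + r ^ 2) ->
  cong 3 ('X^e * gbin 'X (m * n) (m * j + r) ^+ 2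
            * gbin 'X (m * n + (m * j + r)) (m * j + r) ^+ mu)
    (w ^+ 2 * (z ^+ d * ((n%:R - j%:R) ^+ 2 * 'C(n, j)%:R ^+ 2
        * 'C(n + j, j)%:R ^+ mu * (z ^+ r / (z ^+ r - 1) ^+ 2)))%:P).
Proof.
move=> jn rm ze.
have zr0 : z ^+ r - 1 != 0 by rewrite subr_eq0 (prim_expr_neq1 zP).
set k := (m * j + r)%N; set G := gbin 'X _ k; set H := gbin 'X (_ + _)%N _.
apply: (@cong_cancel _ _ _ (('X^k - 1) ^+ 2)).
  by rewrite horner_exp Xsub1_root expf_neq0.
have := gbin_nondiv jn rm; rewrite -/k -/G (subrX1 'X^m).
set v := \sum_(_ < _) _; set H' := gbin _ _ _ => GE.
have -> : ('X^k - 1) ^+ 2 * ('X^e * G ^+ 2 * H ^+ mu)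
    = w ^+ 2 * ('X^e * H ^+ mu * (v * H') ^+ 2).
  transitivity ((G * ('X^k - 1)) ^+ 2 * ('X^e * H ^+ mu)); first by ring.
  by rewrite GE; ring.
apply: cong_trans (cong_scalar _ (w_root zP)) _.
rewrite [X in cong 3 _ X]mulrCA.
apply: cong_sym; apply: cong_trans (cong_scalar _ (w_root zP)) _.
apply: congMC.
rewrite !(horner_exp, hornerM) hornerC hornerX Xsub1_root ze.
have -> : v.[z] = n%:R.
  rewrite horner_sum (eq_bigr (fun=> 1)) => [|i _].
    by rewrite sumr_const card_ord.
  by rewrite !horner_exp hornerX (prim_expr_order zP) expr1n.
rewrite gbin_root; last by case/andP: rm.
rewrite gbin_pred_root // -natrB 1?ltnW //.
have Hg : gbin z m.-1 r.-1 ^+ 2 * z ^+ (r.-1 * r) = 1.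
  have := gbin_pred_sqr m_gt0 zP (r := r.-1).
  by rewrite prednK; [apply; lia | lia].
have -> : z ^+ (d + r ^ 2) = z ^+ d * z ^+ r * z ^+ (r.-1 * r).
  by rewrite -!exprD; congr (_ ^+ _); case: (r) rm => // r' _; lia.
transitivity (z ^+ d * ('C(n + j, j)%:R ^+ mu * (n%:R * 'C(n.-1, j)%:R) ^+ 2
   * z ^+ r)).
  (* Here [n 'C(n-1, j) = (n - j) 'C(n, j)]. *)
  rewrite -natrM mul_bin_down natrM; field; exact: zr0.
transitivity (z ^+ d * ('C(n + j, j)%:R ^+ mu * (n%:R * 'C(n.-1, j)%:R) ^+ 2
   * z ^+ r) * (gbin z m.-1 r.-1 ^+ 2 * z ^+ (r.-1 * r))); last by ring.
by rewrite Hg mulr1.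
Qed.

End Terms.

(** * Summation of the expanded terms *)

Section PolynomialCongruence.

Variables (F : numFieldType) (m : nat) (z : F).
Hypotheses (m_gt0 : (0 < m)%N) (zP : m.-primitive_root z).

Local Notation K := {poly F}.
Local Notation cong := (cong z).
Local Notation w := ('X^m - 1 : K).
Local Notation kappa := ((m%:R ^+ 2 - 1) / 24 : F).

Lemma ratr_coefc lambda mu n k : ratr (coefc lambda mu n k) =
  (if lambda == 2 then n%:R ^+ 2 + (mu%:R - 2) * (n%:R * k%:R / 2)
   else ((lambda%:R + mu%:R) * n%:R - lambda%:R * k%:R) * (k%:R / 2)) :> F.
Proof.
by rewrite /coefc; case: ifP => _;
  rewrite !(rmorph_nat, rmorphXn, rmorphN, rmorphD, rmorphM, fmorphV).
Qed.

(** For [lambda = 2] the two contributions merge through [(2(n-j) + mu n) j/2 + (n-j)^2 = n^2 +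
    (mu-2) n j/2]; otherwise only the first is present. [kappa] is half of [(m^2 - 1)/12]. *)
Lemma second_order_sum lambda mu n :
  \sum_(j < n.+1) kappa * ((lambda%:R * (n%:R - j%:R) + mu%:R * n%:R) * j%:R
       * 'C(n, j)%:R ^+ lambda * 'C(n + j, j)%:R ^+ mu)
  - \sum_(j < n) \sum_(1 <= r < m)
      (if lambda == 2 then (n%:R - j%:R) ^+ 2 * 'C(n, j)%:R ^+ 2
        * 'C(n + j, j)%:R ^+ mu * (z ^+ r / (z ^+ r - 1) ^+ 2) else 0)
  = (m%:R ^+ 2 - 1) / 12 * ratr (sumR lambda mu n).
Proof.
pose N j : F := (if lambda == 2 then (n%:R - j%:R) ^+ 2 * 'C(n, j)%:R ^+ 2
        * 'C(n + j, j)%:R ^+ mu else 0) * - ((m%:R ^+ 2 - 1) / 12).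
rewrite (eq_bigr (fun j : 'I_n => N j)); last first.
  move=> j _; rewrite /N; case: ifP => _; last by rewrite big1 // mul0r.
  by rewrite -mulr_sumr (prim_root_sum m_gt0 zP).
(* The factor [(n - j)^2] vanishes at [j = n], so the two ranges can be matched. *)
have -> : \sum_(j < n) N j = \sum_(j < n.+1) N j.
  have Nn : N n = 0 by rewrite /N subrr expr0n !mul0r if_same mul0r.
  by rewrite big_ord_recr /= Nn addr0.
rewrite -sumrB rmorph_sum mulr_sumr; apply: eq_bigr => j _.
rewrite /= 2!rmorphM /= !rmorphXn /= !rmorph_nat ratr_coefc /N.
by case: eqP => [->|_]; field.
Qed.

(** [e k] stands for [alpha(mn, k) + d]; the hypothesis on powers of [z] encodes that [alpha(mn, k)]
    is congruent to [k^2] modulo [m]. *)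
Lemma qA_poly_cong lambda mu n d (e : nat -> nat) :
  (2 <= lambda)%N ->
  (forall k, (k <= m * n)%N -> z ^+ e k = z ^+ (d + k ^ 2)) ->
  cong 3
   (\sum_(k < (m * n).+1) 'X^(e k) * gbin 'X (m * n) k ^+ lambda
       * gbin 'X (m * n + k) k ^+ mu)
   (\sum_(j < n.+1) 'X^(e (m * j)%N) * gbin 'X^(m ^ 2) n j ^+ lambda
       * gbin 'X^(m ^ 2) (n + j) j ^+ mu
    - 'X^d * ((m%:R ^+ 2 - 1) / 12)%:P * w ^+ 2
        * (ratr (sumR lambda mu n))%:P).
Proof.
move=> l2 ze; rewrite (sum_blocks (fun k => 'X^(e k) * gbin 'X (m * n) k ^+ lambda
       * gbin 'X (m * n + k) k ^+ mu)) //.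
pose N (j r : nat) : F := if lambda == 2 then (n%:R - j%:R) ^+ 2 * 'C(n, j)%:R ^+ 2
        * 'C(n + j, j)%:R ^+ mu * (z ^+ r / (z ^+ r - 1) ^+ 2) else 0.
have zm i j : z ^+ (i + m * j) = z ^+ i.
  by rewrite exprD exprM (prim_expr_order zP) expr1n mulr1.
have ze0 (j : 'I_n.+1) : z ^+ e (m * j)%N = z ^+ d.
  rewrite ze; last by rewrite leq_mul2l -ltnS ltn_ord orbT.
  by rewrite -(zm d (j * (m * j))%N) mulnA mulnn.
have nondiv (j : 'I_n) r : (0 < r < m)%N ->
  cong 3 ('X^(e (m * j + r)%N) * gbin 'X (m * n) (m * j + r) ^+ lambda
       * gbin 'X (m * n + (m * j + r)) (m * j + r) ^+ mu)
    (w ^+ 2 * (z ^+ d * N j r)%:P).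
  move=> rm; have jn := ltn_ord j.
  have kn : (m * j + r <= m * n)%N.
    apply: (leq_trans (n := m * j.+1)); last by rewrite leq_mul2l jn orbT.
    by rewrite mulnS addnC leq_add2r ltnW //; case/andP: rm.
  have zer : z ^+ e (m * j + r)%N = z ^+ (d + r ^ 2).
    rewrite ze // -(zm (d + r ^ 2)%N (j * (m * j + 2 * r))%N).
    by congr (_ ^+ _); ring.
  rewrite /N; case: eqP => [->|/eqP l3].
    exact: (nondivisible_term m_gt0 zP).
  (* For [lambda >= 3], three factors vanishing at [z] kill the term modulo the cube. *)
  rewrite mulr0 polyC0 mulr0 -(subnKC (_ : 3 <= lambda)%N); last by lia.
  set G := gbin _ _ _; set H := gbin _ _ _.
  have -> : 'X^(e (m * j + r)%N) * G ^+ (3 + (lambda - 3)) * H ^+ mu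
      = G ^+ 3 * ('X^(e (m * j + r)%N) * G ^+ (lambda - 3) * H ^+ mu).
    by rewrite exprD; ring.
  exact/cong_exp0/(gbin_nondiv_root m_gt0 zP).
have div (j : 'I_n.+1) : true -> cong 3 _ _ :=
  fun=> divisible_term m_gt0 zP lambda mu (ltn_ord j : (j <= n)%N) (ze0 j).
have D1 := cong_sum (index_enum 'I_n.+1) div.
have D2 : cong 3 (\sum_(j < n) \sum_(1 <= r < m)
    'X^(e (m * j + r)%N) * gbin 'X (m * n) (m * j + r) ^+ lambda
       * gbin 'X (m * n + (m * j + r)) (m * j + r) ^+ mu)
    (\sum_(j < n) \sum_(1 <= r < m) w ^+ 2 * (z ^+ d * N j r)%:P).
  apply: cong_sum => j _.
  rewrite big_seq [X in cong 3 _ X]big_seq; apply: cong_sum => r.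
  by rewrite mem_index_iota; apply: nondiv.
apply: cong_trans (congD D1 D2) _.
rewrite sumrB -addrA; apply: congD (congxx _ _ _) _.
have -> : \sum_(j < n) \sum_(1 <= r < m) w ^+ 2 * (z ^+ d * N j r)%:P
    = w ^+ 2 * (z ^+ d * \sum_(j < n) \sum_(1 <= r < m) N j r)%:P.
  rewrite !mulr_sumr rmorph_sum mulr_sumr; apply: eq_bigr => j _ /=.
  by rewrite mulr_sumr rmorph_sum mulr_sumr.
rewrite -mulr_sumr -(rmorph_sum (@polyC F)) -mulr_sumr /=.
have := second_order_sum lambda mu n; rewrite -/(N _ _).
set SD := \sum_(j < n.+1) _; set SN := \sum_(j < n) _ => S.
have -> : - (w ^+ 2 * (z ^+ d * SD)%:P) + w ^+ 2 * (z ^+ d * SN)%:P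
    = - (w ^+ 2 * (z ^+ d * (SD - SN))%:P) :> K by rewrite mulrBr polyCB; ring.
rewrite {}S.
have -> : 'X^d * ((m%:R ^+ 2 - 1) / 12)%:P * w ^+ 2 * (ratr (sumR lambda mu n))%:P
  = w ^+ 2 * ('X^d * ((m%:R ^+ 2 - 1) / 12)%:P * (ratr (sumR lambda mu n))%:P) :> K.
  by ring.
apply: congN; apply: cong_sym.
apply: cong_trans (cong_scalar _ (w_root zP)) _.
by apply: congMC; rewrite !hornerM !hornerC hornerXn; ring.
Qed.

End PolynomialCongruence.

(** * From congruences at roots of unity to Laurent polynomials *)

Lemma prod_XsubC_exp_dvdp (F : fieldType) (s : seq F) n (p : {poly F}) :
  uniq s -> (forall x, x \in s -> ('X - x%:P) ^+ n %| p) ->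
  (\prod_(x <- s) ('X - x%:P)) ^+ n %| p.
Proof.
elim: s => [_ _|x s IHs /andP[xs us] dvd]; first by rewrite big_nil expr1n dvd1p.
rewrite big_cons exprMn Gauss_dvdp.
  rewrite dvd ?mem_head // IHs // => y ys.
  by rewrite dvd // in_cons ys orbT.
by rewrite coprimep_expl // coprimep_expr // coprimep_sym coprimep_XsubC
  root_prod_XsubC.
Qed.

(** Divisibility over the rationals can be tested over [algC], where the cyclotomic polynomial
    splits into distinct linear factors. *)
Lemma Cyclotomic_exp_dvdp m n (p : {poly rat}) : (0 < m)%N ->
  (forall z : algC, m.-primitive_root z ->
     ('X - z%:P) ^+ n %| map_poly ratr p) ->
  map_poly intr 'Phi_m ^+ n %| p.
Proof.
move=> m0 dvd; have [z zP] := C_prim_root_exists m0.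
rewrite -(dvdp_map (ratr : {rmorphism rat -> algC})) rmorphXn /=.
have -> : map_poly ratr (map_poly intr 'Phi_m) = cyclotomic z m :> {poly algC}.
  rewrite -(Cintr_Cyclotomic zP) -map_poly_comp.
  by apply: eq_map_poly => x /=; rewrite rmorph_int.
rewrite /cyclotomic -big_filter -(big_map (fun k : 'I_m => z ^+ k) xpredT
  (fun x => 'X - x%:P)).
apply: prod_XsubC_exp_dvdp => [|x /mapP[k]].
  rewrite map_inj_in_uniq ?filter_uniq ?index_enum_uniq // => i j _ _ /eqP.
  by rewrite (eq_prim_root_expr zP) !modn_small // => /eqP/val_inj.
rewrite mem_filter => /andP[km _] ->; apply: dvd.
by rewrite (prim_root_exp_coprime _ zP).
Qed.

(** * Evaluation of the exponent polynomial, and transfer to [Qq] *)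

Lemma eval2_subst2 (p a b : {mpoly int[2]}) x y :
  eval2 (subst2 p a b) x y = eval2 p (eval2 a x y) (eval2 b x y).
Proof.
rewrite /eval2 /subst2 comp_mpoly_meval; apply: meval_eq => i.
by case: i => [[|[|i]] // Hi]; rewrite !(tnth_nth 0).
Qed.

Lemma eval2_varn x y : eval2 varn x y = x.
Proof. by rewrite /eval2 mevalXU (tnth_nth 0). Qed.

Lemma eval2_vark x y : eval2 vark x y = y.
Proof. by rewrite /eval2 mevalXU (tnth_nth 0). Qed.

(** Integer polynomials respect congruences; this serves to compare [alpha(mn, k)] with
    [alpha(0, k)] modulo [m]. *)
Lemma dvdz_eval2B d (p : {mpoly int[2]}) x x' y y' :
  (d %| x - x')%Z -> (d %| y - y')%Z ->
  (d %| eval2 p x y - eval2 p x' y')%Z.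
Proof.
move=> dx dy; rewrite /eval2 !mevalE -sumrB.
apply: (big_ind (fun u => (d %| u)%Z)) => [|u v|mm _];
  [exact: dvdz0 | exact: rpredD |].
rewrite -mulrBr dvdz_mull //.
have dM a a' b b' :
    (d %| a - a')%Z -> (d %| b - b')%Z -> (d %| a * b - a' * b')%Z.
  move=> da db; have -> : a * b - a' * b' = (a - a') * b + a' * (b - b') by ring.
  by apply: rpredD; [apply: dvdz_mulr | apply: dvdz_mull].
apply: (big_ind2 (fun a b => (d %| a - b)%Z)) => [||i _].
- by rewrite subrr dvdz0.
- by move=> *; apply: dM.
elim: (mm i) => [|k IHk]; first by rewrite !expr0 subrr dvdz0.
rewrite !exprS; apply: dM => //.
by case: i {IHk} => [[|[|i]] // Hi]; rewrite !(tnth_nth 0).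
Qed.

Lemma q_exp_neq1 i : (0 < i)%N -> q ^+ i != 1.
Proof.
move=> i0; rewrite /q /polyq -tofracXn -tofrac1 tofrac_eq.
exact: Xexp_neq1.
Qed.

Lemma qbinom_Xexp c n k : (0 < c)%N -> (k <= n)%N ->
  qbinom (q ^+ c) n k = polyq (gbin 'X^c n k).
Proof.
move=> c0 kn; rewrite qbinom_gbin //; last first.
  by move=> i i0; rewrite -exprM q_exp_neq1 // muln_gt0 c0.
by rewrite /q /polyq -tofracXn (rmorph_gbin (@tofrac {poly rat})).
Qed.

(* Multiplying by a large power of q clears the negative exponents. *)
Lemma qA_polyq alpha lambda mu c n d (e : nat -> nat) : (0 < c)%N ->
  (forall k, (k <= n)%N -> c%:Z * eval2 alpha n%:Z k%:Z + d%:Z = (e k)%:Z) ->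
  q ^+ d * qA alpha lambda mu (q ^+ c) n
  = polyq (\sum_(k < n.+1) 'X^(e k) * gbin 'X^c n k ^+ lambda
             * gbin 'X^c (n + k) k ^+ mu).
Proof.
move=> c0 eE; rewrite /polyq rmorph_sum mulr_sumr; apply: eq_bigr => k _.
have q0 : q != 0 by rewrite /q /polyq tofrac_eq0 polyX_eq0.
have kn : (k <= n)%N by rewrite -ltnS.
rewrite !qbinom_Xexp ?leq_addl // !rmorphM !rmorphXn !mulrA; congr (_ * _ * _).
by rewrite !exprnP exprz_exp -expfzDr // addrC eE.
Qed.

Theorem theorem2 (lambda mu : nat) (alpha : {mpoly int[2]})
  (lambda_ge2 : (2 <= lambda)%N)
  (alpha_homog : forall m : int,
     subst2 alpha (m *: varn) (m *: vark) = m ^+ 2 *: alpha)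
  (alpha_0k : subst2 alpha 0 vark = vark ^+ 2)
  (m n : nat) (m_gt0 : (0 < m)%N) :
  congr_laurent
    (qA alpha lambda mu q (m * n))
    (qA alpha lambda mu (q ^+ (m ^ 2)) n
      - constq ((m%:R ^+ 2 - 1) / 12) * (q ^+ m - 1) ^+ 2
        * constq (sumR lambda mu n))
    (Phiq m ^+ 3).
Proof.
have q0 : q != 0 by rewrite /q /polyq tofrac_eq0 polyX_eq0.
have alphaM (j : nat) : eval2 alpha (m * n)%N%:Z (m * j)%N%:Z
    = (m ^ 2)%N%:Z * eval2 alpha n%:Z j%:Z.
  have := congr1 (fun p => eval2 p n%:Z j%:Z) (alpha_homog m%:Z).
  rewrite eval2_subst2 /eval2 !mevalZ -!/(eval2 _ _ _) eval2_varn eval2_vark.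
  by rewrite -!PoszM => ->; rewrite -mulnn PoszM expr2.
have alpha0 (k : nat) : eval2 alpha 0 k%:Z = (k ^ 2)%N%:Z.
  have := congr1 (fun p => eval2 p 0 k%:Z) alpha_0k.
  rewrite eval2_subst2 /eval2 meval0 rmorphXn /= -!/(eval2 _ _ _) eval2_vark.
  by move=> ->; rewrite -mulnn PoszM expr2.
(* The sum of absolute values bounds each exponent, so shifting by [d] makes all of them
   nonnegative. *)
pose d := (\sum_(k < (m * n).+1) `|eval2 alpha (m * n)%N%:Z k%:Z|)%N.
pose e (k : nat) := absz (eval2 alpha (m * n)%N%:Z k%:Z + d%:Z).
have eE k : (k <= m * n)%N -> eval2 alpha (m * n)%N%:Z k%:Z + d%:Z = (e k)%:Z.
  move=> kn; rewrite /e gez0_abs //.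
  have : (absz (eval2 alpha (m * n)%N%:Z k%:Z) <= d)%N.
    by rewrite /d (bigD1 (Ordinal (kn : k < (m * n).+1)%N)) //= leq_addr.
  lia.
have L1 := @qA_polyq alpha lambda mu 1 (m * n) d e isT.
(* By homogeneity [m^2 alpha(n, j) = alpha(mn, mj)], so the same [d] and [e] serve both sums. *)
have L2 := @qA_polyq alpha lambda mu (m ^ 2) n d (fun j => e (m * j)%N).
rewrite !expr1 in L1.
set P1 := \sum_(k < _) _ in L1; set P2 := \sum_(k < _) _ in L2.
pose P := P1 - (P2 - 'X^d * ((m%:R ^+ 2 - 1) / 12)%:P * ('X^m - 1) ^+ 2
   * (sumR lambda mu n)%:P).
have /dvdpP[h hE] : map_poly intr 'Phi_m ^+ 3 %| P.
  apply: Cyclotomic_exp_dvdp => // z zP.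
  have := @qA_poly_cong _ _ _ m_gt0 zP lambda mu n d e lambda_ge2.
  rewrite congE => dvd; apply: eq_rect (dvd _) _ _ => [k kn|].
    (* The difference of the exponents is [alpha(mn, k) - alpha(0, k)], a multiple of [m]. *)
    apply/eqP; rewrite (eq_prim_root_expr zP) -eqz_nat -!modz_nat eqz_mod_dvd.
    rewrite -eE // PoszD -alpha0 [X in _ - X]addrC opprD addrACA subrr addr0.
    by apply: dvdz_eval2B; rewrite ?subrr ?dvdz0 // subr0 PoszM dvdz_mulr.
  have cE : ratr ((m%:R ^+ 2 - 1) / 12) = (m%:R ^+ 2 - 1) / 12 :> algC.
    by rewrite !(rmorph_nat, rmorph1, rmorphXn, rmorphN, rmorphD, rmorphM, fmorphV).
  rewrite /P /P1 /P2 -cE.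
  move: (sumR lambda mu n) ((_ - 1) / 12) => s c; congr dvdp.
  rewrite !rmorphB !rmorph_sum /=; congr (_ - (_ - _)).
  - apply: eq_bigr => k _; rewrite !rmorphM !rmorphXn /= !rmorph_gbin.
    by rewrite /= !map_polyX.
  - apply: eq_bigr => k _; rewrite !rmorphM !rmorphXn /= !rmorph_gbin.
    by rewrite !rmorphXn /= !map_polyX.
  rewrite !(rmorphXn (map_poly _), rmorphM (map_poly _)) /= !map_polyC /= map_polyX.
  by rewrite rmorphB rmorphXn rmorph1 /= map_polyX.
have {}L1 := L1 (fun k kn => etrans (congr1 (+%R^~ _) (mul1r _)) (eE k kn)).
have {}L2 : q ^+ d * qA alpha lambda mu (q ^+ (m ^ 2)) n = polyq P2.
  apply: L2 => [|k kn]; first by rewrite expn_gt0 m_gt0.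
  by rewrite -alphaM eE // leq_mul2l kn orbT.
have PE : q ^+ d * (qA alpha lambda mu q (m * n)
    - (qA alpha lambda mu (q ^+ (m ^ 2)) n
      - constq ((m%:R ^+ 2 - 1) / 12) * (q ^+ m - 1) ^+ 2
        * constq (sumR lambda mu n))) = polyq P.
  have -> : polyq P = polyq P1 - (polyq P2 - q ^+ d
     * constq ((m%:R ^+ 2 - 1) / 12) * (q ^+ m - 1) ^+ 2
        * constq (sumR lambda mu n)).
    rewrite /P /constq /q /polyq; move: (sumR _ _ _) (_ / _) => s c.
    rewrite !rmorphB !(rmorphXn (@tofrac _), rmorphM (@tofrac _)) rmorphB.
    by rewrite rmorphXn rmorph1.
  by rewrite -L1 -L2 !(mulrBr (q ^+ d)) !mulrA.
(* Dividing by [q ^+ d] undoes the shift of the exponents and stays within Laurent polynomials. *)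
exists (polyq h / q ^+ d); first by exists h, d.
apply: (mulfI (expf_neq0 d q0)); rewrite PE.
rewrite hE /Phiq /polyq rmorphM rmorphXn /=.
have divfM (F : fieldType) (a b c : F) : a != 0 -> b * c = a * (b / a * c).
  by move=> a0; field.
exact/divfM/expf_neq0.
Qed.
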